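(* For $n>1$, there are continuum many ($2^{\aleph_0}$) $\sqcup$-irreducible elements in $\widehat{\mathcal F_n}$.
   Context: Fix $n\ge1$ and symbols $P_1,\dots,P_n$. The partially ordered set $(K_n,\le)$ with valuation map $\mathrm{val}:K_n\to\mathfrak P(\{P_1,\dots,P_n\})$ is the increasing union of finite sets $K_n^d$ ($d\ge 0$) built recursively: $K_n^{-1}=\emptyset$, and $K_n^d\setminus K_n^{d-1}$ consists of exactly one point $w_{\beta,Y}$ for each pair $(\beta,Y)$ such that (i) $Y$ is a decreasing subset of $K_n^{d-1}$ with $Y\not\subseteq K_n^{d-2}$ (for $d=0$ this last condition is void, so $Y=\emptyset$); (ii) $\beta\subseteq\{P_1,\dots,P_n\}$ and $\beta\subseteq\mathrm{val}(w')$ for all $w'\in Y$; (iii) if $Y$ is the decreasing set generated by a single element $w_{\beta',Y'}$, then $\beta\ne\beta'$. One sets $\mathrm{val}(w_{\beta,Y})=\beta$, and $w\le w_{\beta,Y}$ iff $w\in Y$ or $w=w_{\beta,Y}$. $\widehat{\mathcal F_n}:=\mathcal O_\downarrow(K_n,\le)$ is the Heyting algebra of all decreasing subsets of $K_n$ ($\sqcap=\cap$, $\sqcup=\cup$). An element $a$ of a lattice is $\sqcup$-irreducible if $a\ne0$ and $a$ cannot be written as $b_1\sqcup b_2$ with $b_1\neq a$ and $b_2\ne a$. *)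

(* Defs.v *)
From HB Require Import structures.
From mathcomp Require Import all_boot all_order finmap.
From mathcomp Require Import boolp classical_sets functions cardinality.

Set Implicit Arguments.
Unset Strict Implicit.
Unset Printing Implicit Defensive.

Import Order.TTheory.

Section Points.
Variable n : nat.
Local Open Scope fset_scope.

(* The point w_{beta,Y} is the pair (beta, Y), with Y a finite set of points.
   As such pairs form a countable type, they are coded by natural numbers, which
   makes points eligible as elements of finite sets of points.  The symbols
   P_1, ..., P_n are the elements of 'I_n. *)
Definition mkpt (beta : {set 'I_n}) (Y : {fset nat}) : nat := choice.pickle (beta, Y).

Definition ptval (w : nat) : {set 'I_n} :=
  if @choice.unpickle ({set 'I_n} * {fset nat})%type w is Some p then p.1 else finset.set0.

Definition ptlow (w : nat) : {fset nat} :=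
  if @choice.unpickle ({set 'I_n} * {fset nat})%type w is Some p then p.2 else fset0.

Definition ptle (w w' : nat) : bool := (w \in ptlow w') || (w == w').

Definition dec_subset (Y A : {fset nat}) : Prop :=
  Y `<=` A /\ forall w w', w \in A -> w' \in Y -> ptle w w' -> w \in Y.

Definition dec_gen (A : {fset nat}) (w' : nat) : {fset nat} :=
  [fset w in A | ptle w w'].

Definition admissible (A : {fset nat}) (beta : {set 'I_n}) (Y : {fset nat}) :=
  [/\ dec_subset Y A,
      forall w', w' \in Y -> beta \subset ptval w' &
      forall w', w' \in A -> Y = dec_gen A w' -> beta <> ptval w'].

(* The index is shifted by one: Kpre d is K_n^(d-1), and Kpre 0 is empty. *)
Fixpoint Kpre (d : nat) : {fset nat} :=
  if d is e.+1 then
    Kpre e `|`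
    [fset mkpt beta Y | beta : {set 'I_n}, Y in fpowerset (Kpre e)
      & `[< admissible (Kpre e) beta Y >] &&
        (if e is e'.+1 then ~~ (Y `<=` Kpre e') else true)]
  else fset0.

Lemma mkptval beta Y : ptval (mkpt beta Y) = beta.
Proof. by rewrite /ptval /mkpt choice.pickleK. Qed.

Lemma mkptlow beta Y : ptlow (mkpt beta Y) = Y.
Proof. by rewrite /ptlow /mkpt choice.pickleK. Qed.

Lemma KpreS e w : reflect
  (w \in Kpre e \/ exists beta Y, [/\ w = mkpt beta Y, admissible (Kpre e) beta Y
     & (if e is e'.+1 then ~~ (Y `<=` Kpre e') else true) : bool])
  (w \in Kpre e.+1).
Proof.
rewrite [Kpre _.+1]/= in_fsetU; apply: (iffP orP) => -[wK|wN]; try by left.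
- right; case/imfset2P: wN => beta _ [Y]; rewrite inE => /and3P[YK /asboolP aY YN] ->.
  by exists beta; exists Y; split.
- right; case: wN => beta [Y [-> aY YN]]; apply/imfset2P.
  exists beta => //; exists Y => //; rewrite inE YN andbT fpowersetE.
  by case: (aY) => -[-> _] _ _; apply/asboolP.
Qed.

Lemma Kpre_sub d e : (d <= e)%N -> Kpre d `<=` Kpre e.
Proof.
move=> /subnKC <-; elim: (e - d)%N => [|k IH]; first by rewrite addn0.
rewrite addnS; apply: fsubset_trans IH _.
by apply/fsubsetP => w wK; apply/KpreS; left.
Qed.

Lemma KpreP d w : w \in Kpre d.+1 -> exists e beta Y,
  [/\ (e <= d)%N, w = mkpt beta Y, dec_subset Y (Kpre e) & Y `<=` Kpre d].
Proof.
elim: d => [|d IH] /KpreS [|[beta [Y [-> [YK _ _] _]]]] //.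
- by exists 0, beta, Y; split=> //; case: YK.
- move=> /IH [e [beta [Y [ed -> YK Yd]]]]; exists e, beta, Y.
  by split=> //; [exact: leqW | apply: fsubset_trans Yd _; apply: Kpre_sub].
- by exists d.+1, beta, Y; split=> //; case: YK.
Qed.

Lemma ptlow_irr d x y : x \in Kpre d -> y \in Kpre d ->
  x \in ptlow y -> y \in ptlow x -> False.
Proof.
elim: d x y => [|d IH] // x y /KpreP[e [b [Y [_ -> _ /fsubsetP Yd]]]].
move=> /KpreP[e' [b' [Y' [_ -> _ /fsubsetP Yd']]]].
rewrite !mkptlow => xy yx; apply: (IH _ _ (Yd' _ xy) (Yd _ yx)).
  by rewrite mkptlow.
by rewrite mkptlow.
Qed.

Lemma ptlow_trans d x y z : z \in Kpre d ->
  x \in ptlow y -> y \in ptlow z -> x \in ptlow z.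
Proof.
case: d => // d /KpreP[e [b [Y [ed -> [YK Ydec] _]]]]; rewrite !mkptlow => xy yz.
apply: (Ydec x y) => //; last by rewrite /ptle xy.
have /(_ y yz) := fsubsetP YK; case: e ed {YK Ydec} => // e _.
move=> /KpreP[e2 [b2 [Y2 [_ ye _ /fsubsetP sub]]]].
by apply/(fsubsetP (Kpre_sub (leqnSn e)))/sub; move: xy; rewrite ye mkptlow.
Qed.

Definition inK : pred nat := fun w => `[< exists d, w \in Kpre d >].

Definition K : Type := {w : nat | inK w}.

HB.instance Definition _ := SubType.on K.
HB.instance Definition _ := [Countable of K by <:].

Definition val_K (w : K) : {set 'I_n} := ptval (\val w).

Definition leK (w w' : K) : bool := ptle (\val w) (\val w').

Lemma leK_refl : reflexive leK.
Proof. by move=> x; rewrite /leK /ptle eqxx orbT. Qed.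

Lemma leK_anti : antisymmetric leK.
Proof.
move=> x y /andP[/orP[xy|/eqP xy]]; last by move=> _; apply: val_inj.
move=> /orP[yx|/eqP yx]; last by apply/val_inj/esym.
have [/asboolP[d xd] /asboolP[e ye]] := (valP x, valP y).
case: (@ptlow_irr (maxn d e) (\val x) (\val y)) => //.
  by apply: (fsubsetP (Kpre_sub (leq_maxl d e))).
by apply: (fsubsetP (Kpre_sub (leq_maxr d e))).
Qed.

Lemma leK_trans : transitive leK.
Proof.
move=> y x z /orP[xy|/eqP xy]; last by rewrite /leK xy.
move=> /orP[yz|/eqP yz]; last by rewrite /leK -yz /ptle xy.
have /asboolP[d zd] := valP z.
by rewrite /leK /ptle (ptlow_trans zd xy yz).
Qed.

Fact K_display : Order.disp_t. Proof. exact: Order.Disp tt tt. Qed.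

HB.instance Definition _ :=
  Order.Le_isPOrder.Build K_display K leK_refl leK_anti leK_trans.

End Points.

Section DecreasingSets.
Context {d : Order.disp_t} (T : porderType d).
Local Open Scope order_scope.

Definition decreasing (A : set T) : Prop := forall x y, x <= y -> A y -> A x.

Definition decreasingb : pred (set T) := fun A => `[< decreasing A >].

Definition downset : Type := {A : set T | decreasingb A}.

HB.instance Definition _ := SubType.on downset.
HB.instance Definition _ := [Choice of downset by <:].

Fact decreasing_opredI : {in decreasingb &, forall A B, A `&` B \in decreasingb}.
Proof.
move=> A B /asboolP dA /asboolP dB; apply/asboolP => x y xy [Ay By].
by split; [apply: dA xy Ay | apply: dB xy By].
Qed.

Fact decreasing_opredU : {in decreasingb &, forall A B, A `|` B \in decreasingb}.
Proof.
move=> A B /asboolP dA /asboolP dB; apply/asboolP => x y xy [Ay|By].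
  by left; apply: dA xy Ay.
by right; apply: dB xy By.
Qed.

Fact decreasing_opred0 : \bot \in decreasingb.
Proof. by apply/asboolP => x y _ []. Qed.

Fact decreasing_opred1 : \top \in decreasingb.
Proof. exact/asboolP. Qed.

Fact downset_display : Order.disp_t. Proof. exact: Order.Disp tt tt. Qed.

HB.instance Definition _ :=
  Order.SubChoice_isTBSubLattice.Build _ _ decreasingb downset_display downset
    decreasing_opredI decreasing_opredU decreasing_opred0 decreasing_opred1.

Fact downset_meetUl : @left_distributive downset downset Order.meet Order.join.
Proof. by move=> A B C; apply: val_inj; apply: meetUl. Qed.

HB.instance Definition _ :=
  Order.Lattice_Meet_isDistrLattice.Build downset_display downset downset_meetUl.

Definition himp_set (A B : set T) : set T :=
  [set x | forall y, y <= x -> A y -> B y].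

Fact himp_decreasing (A B : downset) : decreasingb (himp_set (\val A) (\val B)).
Proof. by apply/asboolP => x y xy AB z zx; apply: AB; apply: le_trans zx xy. Qed.

Definition himp (A B : downset) : downset := Sub _ (himp_decreasing A B).

(* The residuation law: the decreasing sets form a Heyting algebra. *)
Lemma le_himp (A B C : downset) : (C `&` A <= B) = (C <= himp A B).
Proof.
rewrite -!Order.le_val; apply/idP/idP => /subsetPset CAB;
  apply/subsetPset.
  move=> x Cx y yx Ay; apply: CAB; split=> //.
  by have /asboolP dC := valP C; apply: dC yx Cx.
by move=> x [Cx Ax]; apply: (CAB _ Cx).
Qed.

End DecreasingSets.

Definition Fhat (n : nat) := downset (K n).

Definition join_irreducible {d : Order.disp_t} {L : bLatticeType d} (a : L) : Prop :=
  a <> \bot%O /\ ~ exists b1 b2 : L, [/\ a = (b1 `|` b2)%O, b1 <> a & b2 <> a].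

(* Main.v *)
(* A nonempty directed decreasing set is join-irreducible, so it suffices to
   find 2^aleph_0 increasing chains generating distinct decreasing sets.  The
   points of valuation containing P_1 include an infinite Rieger-Nishimura
   ladder l_0 < l_1 < ..., and the points a_k of empty valuation lying directly
   above l_k form an antichain, since everything strictly below a_k has nonempty
   valuation.  A subset S of the naturals is coded by the chain of points of
   empty valuation which at stage k is left unchanged if k is not in S, and
   otherwise moves to the point directly above its current value and a_k.
   Conversely K_n is countable, so it has at most 2^aleph_0 subsets. *)
Require Import Defs.
From mathcomp Require Import all_boot all_order finmap.
From mathcomp Require Import boolp classical_sets functions cardinality.

Set Implicit Arguments.
Unset Strict Implicit.
Unset Printing Implicit Defensive.

Import Order.TTheory.

Local Open Scope classical_set_scope.
Local Open Scope card_scope.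

(** If [a] is a union of proper [b1] and [b2], take [x] in [a] outside [b1] and [y] in [a] outside
    [b2]: their upper bound [z] lies in some [bi], which is decreasing and so contains [x] or [y]
    accordingly. *)
Lemma directed_join_irreducible {d : Order.disp_t} {T : porderType d}
    (a : downset T) (x0 : T) :
  \val a x0 ->
  (forall x y, \val a x -> \val a y ->
     exists z, [/\ \val a z, (x <= z)%O & (y <= z)%O]) ->
  join_irreducible a.
Proof.
move=> ax0 dir; split=> [a0|[b1 [b2 [ab b1a b2a]]]].
  by move: ax0; rewrite a0.
have aU : \val a = \val b1 `|` \val b2 by rewrite ab.
have proper (b : downset T) : \val b `<=` \val a -> b <> a ->
    exists2 x, \val a x & ~ \val b x.
  move=> ba nba; apply: contrapT => nx; apply: nba; apply: val_inj.
  apply/seteqP; split=> // x ax; apply: contrapT => bx.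
  by apply: nx; exists x.
have [|x ax bx] := proper b1 _ b1a; first by rewrite aU; left.
have [|y ay bY] := proper b2 _ b2a; first by rewrite aU; right.
have [z [az xz yz]] := dir x y ax ay.
move: az; rewrite aU => -[bz|bz].
  by apply: bx; have /asboolP db := valP b1; apply: db xz bz.
by apply: bY; have /asboolP db := valP b2; apply: db yz bz.
Qed.

(** * Points lying directly above a finite set *)

Section Points.
Variable n : nat.
Implicit Types (x y z : K n) (s : seq (K n)) (beta : {set 'I_n}).

Lemma Kpre_down e u w : w \in Kpre n e -> ptle n u w -> u \in Kpre n e.
Proof.
case: e => // e we /orP[uw|/eqP -> //].
have /KpreP[f [b [Y [_ wE _ /fsubsetP Ye]]]] := we.
apply: (fsubsetP (Kpre_sub n (leqnSn e))); apply: Ye.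
by move: uw; rewrite wE mkptlow.
Qed.

Lemma ptval_mono e u w : w \in Kpre n e -> ptle n u w ->
  ptval n w \subset ptval n u.
Proof.
move=> we /orP[|/eqP -> //]; elim: e we => // e IH /KpreS[//|].
by move=> [b [Y [-> [_ bY _] _]]]; rewrite mkptlow mkptval => /bY.
Qed.

Lemma val_K_le x y : (x <= y)%O -> val_K y \subset val_K x.
Proof. by move=> xy; have /asboolP[e ye] := valP y; exact: (ptval_mono ye xy). Qed.

Lemma seq_Kpre s : exists e, all (fun x => \val x \in Kpre n e) s.
Proof.
elim: s => [|x s [e se]]; first by exists 0.
have /asboolP[f xf] := valP x; exists (maxn f e) => /=; apply/andP; split.
  exact: (fsubsetP (Kpre_sub n (leq_maxl f e))).
by apply: sub_all se => y; apply: (fsubsetP (Kpre_sub n (leq_maxr f e))).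
Qed.

(** Describes $w_{\beta,Y}$ by order and valuation alone, so that later constructions need not refer
    to ranks. *)
Definition covers s beta w : Prop :=
  val_K w = beta /\ forall u, (u < w)%O = has (fun x => (u <= x)%O) s.

(* [w_{beta,Y}] exists in [K n], where [Y] is the decreasing set generated by
   [s]; its rank is the least [e] with [Y] contained in [Kpre e]. *)
Lemma exists_cover s beta :
  (forall x, x \in s -> beta \subset val_K x) ->
  (forall x, x \in s -> (forall y, y \in s -> (y <= x)%O) -> beta <> val_K x) ->
  exists w, covers s beta w.
Proof.
move=> sb snb; have [e0 /allP se0] := seq_Kpre s.
pose Y := [fset u in Kpre n e0 | has (fun x => ptle n u (\val x)) s]%fset.
have YE (u : K n) : (\val u \in Y) = has (fun x => (u <= x)%O) s.
  rewrite !inE /=; apply: andb_idl => /hasP[x xs ux].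
  exact: Kpre_down (se0 _ xs) ux.
have Yk u : u \in Y -> exists v : K n, u = \val v.
  rewrite !inE => /andP[/= ue _].
  have uK : inK n u by apply/asboolP; exists e0.
  by exists (Sub u uK).
have sY x : x \in s -> \val x \in Y by move=> xs; rewrite YE; apply/hasP; exists x.
have exP : exists e, (Y `<=` Kpre n e)%fset.
  by exists e0; apply/fsubsetP => u; rewrite !inE => /andP[].
case: (ex_minnP exP) => e Ye emin.
have wK : mkpt beta Y \in Kpre n e.+1.
  apply/KpreS; right; exists beta, Y; split=> //; last first.
    by case: e emin {Ye} => // e emin; apply/negP => /emin; rewrite ltnn.
  split.
  - split=> // u v _ /[dup] vY; rewrite !inE => /andP[/= ve /hasP[x xs vx]] uv.
    have ue := Kpre_down ve uv.
    rewrite ue /=; apply/hasP; exists x => //.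
    have [v' ?] := Yk _ vY; subst v.
    have uK : inK n u by apply/asboolP; exists e0.
    exact: (@le_trans _ (K n) v' (Sub u uK) x uv vx).
  - move=> u uY; have [v ?] := Yk _ uY; subst u.
    move: uY; rewrite YE => /hasP[x /sb bx vx].
    exact: fintype.subset_trans bx (val_K_le vx).
  (* A single generator of [Y] lies below some [x] in [s] and above all of [s], so it equals [x],
     the greatest element of [s]. *)
  - move=> u ue YG; have uY : u \in Y by rewrite YG !inE ue /ptle eqxx orbT.
    have [v ?] := Yk _ uY; subst u.
    have le_v y : y \in s -> (y <= v)%O.
      by move=> /sY; rewrite YG !inE => /andP[].
    move: uY; rewrite YE => /hasP[x xs vx].
    have -> : v = x by apply: le_anti; rewrite vx le_v.
    by apply: (snb x xs) => y /le_v yv; apply: (le_trans yv vx).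
have wI : inK n (mkpt beta Y) by apply/asboolP; exists e.+1.
exists (Sub _ wI); split=> [|u]; first by rewrite /val_K SubK mkptval.
rewrite lt_neqAle -YE /Order.le /= /leK SubK /ptle mkptlow.
have [->|uw] /= := eqVneq u (Sub _ wI).
  apply/esym/negP => wY.
  by apply: (@ptlow_irr n _ _ _ wK wK); rewrite mkptlow.
case: eqP => [uE|_]; last by rewrite orbF.
by case/eqP: uw; apply: val_inj.
Qed.

Lemma exists_cover_fun : exists mk : seq (K n) -> {set 'I_n} -> K n,
  forall s beta,
  (forall x, x \in s -> beta \subset val_K x) ->
  (forall x, x \in s -> (forall y, y \in s -> (y <= x)%O) -> beta <> val_K x) ->
  covers s beta (mk s beta).
Proof.
have [o _] := @exists_cover [::] finset.set0 ltac:(done) ltac:(done).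
have /choice[mk mkP] : forall p : seq (K n) * {set 'I_n}, exists w,
    (exists w', covers p.1 p.2 w') -> covers p.1 p.2 w.
  move=> p; have [[w cw]|nw] := pselect (exists w', covers p.1 p.2 w').
    (* When no such point exists, [o] serves as a default value. *)
    by exists w.
  by exists o.
exists (fun s beta => mk (s, beta)) => s beta h1 h2.
exact/mkP/exists_cover.
Qed.

(** * The ladder and the antichain above it *)

Lemma exists_antichain : 1 < n -> exists a : nat -> K n,
  [/\ forall i, val_K (a i) = finset.set0,
      forall i j, (a i <= a j)%O -> i = j &
      forall i u, (u < a i)%O -> val_K u <> finset.set0].
Proof.
move=> n1; have [mk mkP] := exists_cover_fun.
pose i0 : 'I_n := Ordinal (ltnW n1); pose i1 : 'I_n := Ordinal n1.
pose alpha := [set i0]%SET.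
have val0 x : alpha \subset val_K x -> val_K x <> finset.set0.
  by move=> /[swap] ->; rewrite finset.subset0 => /eqP/setP/(_ i0); rewrite !inE eqxx.
have mk2P x y : alpha \subset val_K x -> alpha \subset val_K y ->
    ~~ (x <= y)%O -> ~~ (y <= x)%O -> covers [:: x; y] alpha (mk [:: x; y] alpha).
  move=> ax ay xy yx; apply: mkP => z; rewrite !inE => /orP[]/eqP-> //.
    by move=> /(_ y); rewrite !inE eqxx orbT => /(_ isT); rewrite (negPf yx).
  by move=> /(_ x); rewrite !inE eqxx => /(_ isT); rewrite (negPf xy).
(* Invariant for the ladder: with [x, y] and [y, z] incomparable and not
   [z <= x], the least point [w] of valuation [alpha] above [x] and [y] makes
   [(y, z, w)] satisfy the same conditions. *)
pose inv (t : K n * K n * K n) := let: (x, y, z) := t in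
  [/\ [/\ alpha \subset val_K x, alpha \subset val_K y & alpha \subset val_K z],
      ~~ (x <= y)%O /\ ~~ (y <= x)%O, ~~ (y <= z)%O /\ ~~ (z <= y)%O &
      ~~ (z <= x)%O].
pose step (t : K n * K n * K n) := let: (x, y, z) := t in (y, z, mk [:: x; y] alpha).
have step_inv t : inv t -> inv (step t).
  case: t => [[x y] z] [[ax ay az] [xy yx] [yz zy] zx].
  have [vw wP] := mk2P x y ax ay xy yx; rewrite /=.
  set w := mk _ _ in vw wP *.
  have ltw u : (u < w)%O = (u <= x)%O || (u <= y)%O by rewrite wP /= orbF.
  have xw : (x < w)%O by rewrite ltw lexx.
  have yw : (y < w)%O by rewrite ltw lexx orbT.
  split=> //; first by rewrite vw.
  - split; last first.
      by apply: contra yz => /(lt_le_trans yw)/ltW.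
    rewrite le_eqVlt ltw (negPf zx) (negPf zy) /= orbF.
    by apply: contra yz => /eqP ->; apply: ltW.
  - by rewrite (lt_geF yw).
(* The ladder starts from two minimal points [a] and [b], of valuations $\{P_1,P_2\}$ and $\{P_1\}$,
   and the point [c] of valuation $\{P_1\}$ directly above [a]. Here $n>1$ separates [a] from
   [b]. *)
have [t0 t0P] : exists t, inv t.
  have [||va aP] := mkP [::] [set i0; i1]%SET => //.
  have [||vb bP] := mkP [::] alpha => //.
  set a := mk _ _ in va aP; set b := mk _ _ in vb bP.
  have alpha2 : alpha != [set i0; i1]%SET.
    by apply/eqP => /setP/(_ i1); rewrite !inE eqxx orbT.
  have ab : a != b by apply: contra alpha2 => /eqP ab; rewrite -va ab vb.
  have aa : alpha \subset val_K a by rewrite va finset.subsetUl.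
  have [||vc cP] := mkP [:: a] alpha.
  - by move=> x; rewrite inE => /eqP->.
  - by move=> x; rewrite inE => /eqP-> _; apply/eqP; rewrite va.
  set c := mk _ _ in vc cP.
  have ac : (a < c)%O by rewrite cP /= lexx.
  have a_b : ~~ (a <= b)%O by rewrite le_eqVlt bP orbF.
  have b_a : ~~ (b <= a)%O by rewrite le_eqVlt aP orbF eq_sym.
  have c_b : ~~ (c <= b)%O by apply: contra a_b; apply/le_trans/ltW.
  exists (a, b, c); split=> //; first by rewrite vb vc.
    split=> //; rewrite le_eqVlt cP /= orbF negb_or b_a andbT.
    by apply: contra a_b => /eqP ->; apply: ltW.
  by rewrite lt_geF.
(* Consecutive rungs are incomparable, but two steps from [(x, y, z)] add a point above [y] and [z];
   hence every second rung gives an increasing chain. *)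
pose l k := (iter k (step \o step) t0).2.
have invP k : inv (iter k (step \o step) t0).
  by elim: k => // k IH; apply/step_inv/step_inv.
have l_alpha k : alpha \subset val_K (l k).
  by rewrite /l; case: (iter _ _ _) (invP k) => [[x y] z] [[]].
have l_mono : {homo l : i j / i < j >-> (i < j)%O}.
  apply: homo_ltn => [y x z|k]; first exact: lt_trans.
  rewrite /l iterS; case: (iter _ _ _) (invP k) => [[x y] z].
  by case=> [[ax ay az] _ [yz zy] _] /=; rewrite (mk2P y z _ _ _ _).2 //= lexx orbT.
have l_inj i j : l i = l j -> i = j.
  by move=> lij; case: (ltngtP i j) => // /l_mono; rewrite lij ltxx.
have aP k : covers [:: l k] finset.set0 (mk [:: l k] finset.set0).
  apply: mkP => x; rewrite inE => /eqP->; first by rewrite finset.sub0set.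
  by move=> _ /esym; apply: val0.
have below i u : (u < mk [:: l i] finset.set0)%O -> val_K u <> finset.set0.
  rewrite (aP i).2 /= orbF => /val_K_le lu; apply: val0.
  exact: fintype.subset_trans (l_alpha i) lu.
exists (fun k => mk [:: l k] finset.set0); split=> [i|i j|i u].
- by have [] := aP i.
- rewrite le_eqVlt => /orP[/eqP ij|/below]; last by rewrite (aP i).1.
  (* Equal points have the same strict lower bounds, of which [l i] and [l j] are both the
     greatest. *)
  apply: l_inj; apply: le_anti; apply/andP; split.
    by have := (aP j).2 (l i); rewrite /= orbF => <-; rewrite -ij (aP i).2 /= lexx.
  by have := (aP i).2 (l j); rewrite /= orbF => <-; rewrite ij (aP j).2 /= lexx.
- exact: below.
Qed.

(** * Coding subsets of the naturals by increasing chains *)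

Definition down (c : nat -> K n) : set (K n) := [set x | exists k, (x <= c k)%O].

Lemma down_decreasing c : decreasingb (down c).
Proof. by apply/asboolP => x y xy [k yk]; exists k; apply: le_trans yk. Qed.

Definition downK c : Fhat n := Sub _ (down_decreasing c).

Lemma chain_join_irreducible (c : nat -> K n) :
  (forall k, (c k <= c k.+1)%O) -> join_irreducible (downK c).
Proof.
move=> cS; have c_homo : {homo c : i j / i <= j >-> (i <= j)%O}.
  by apply: homo_leq => // y x z; apply: le_trans.
apply: (@directed_join_irreducible _ _ _ (c 0)) => [|x y [i xi] [j yj]].
  by exists 0.
exists (c (maxn i j)); split; first by exists (maxn i j).
  by apply: le_trans xi _; apply/c_homo/leq_maxl.
by apply: le_trans yj _; apply/c_homo/leq_maxr.
Qed.

(* The antichain of [exists_antichain] is coded into chains: at stage [k], the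
   chain passes above [a k.+1] exactly when [f k] holds. *)
Lemma exists_coding : 1 < n -> exists I : (nat -> bool) -> Fhat n,
  injective I /\ forall f, join_irreducible (I f).
Proof.
move=> n1; have [mk mkP] := exists_cover_fun.
have [a [va a_inj a_below]] := exists_antichain n1.
pose c f := fix c k := if k is j.+1 then
  if f j then mk [:: c j; a j.+1] finset.set0 else c j else a 0.
(* The middle clause serves twice: it recovers [f] from the chain, and it keeps [c f k] and [a k.+1]
   incomparable when [f k] holds, so that the next point exists. *)
have cP (f : nat -> bool) k : val_K (c f k) = finset.set0 /\
    (forall i, (a i.+1 <= c f k)%O -> f i && (i < k)) /\
    (f k -> covers [:: c f k; a k.+1] finset.set0 (c f k.+1)).
  have cov j : val_K (c f j) = finset.set0 ->
      (forall i, (a i.+1 <= c f j)%O -> f i && (i < j)) ->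
      f j -> covers [:: c f j; a j.+1] finset.set0 (c f j.+1).
    move=> vc ck fj; rewrite /= fj; apply: mkP => x xs; first by rewrite finset.sub0set.
    move=> top _; have ax : (a j.+1 <= x)%O by apply: top; rewrite !inE eqxx orbT.
    have cx : (c f j <= x)%O by apply: top; rewrite !inE eqxx.
    move: xs ax cx; rewrite !inE => /orP[]/eqP-> ac ca.
      by have := ck j ac; rewrite ltnn andbF.
    move: ca; rewrite le_eqVlt => /orP[/eqP cE|/a_below //].
    by have := ck j; rewrite cE lexx ltnn andbF => /(_ isT).
  elim: k => [|k [vc [ck ckS]]].
    have v0 : val_K (c f 0) = finset.set0 := va 0.
    have c0 i : (a i.+1 <= c f 0)%O -> f i && (i < 0) by move=> /a_inj.
    by split=> //; split=> // f0; apply: cov.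
  have vS : val_K (c f k.+1) = finset.set0.
    by have [/ckS[]|nfk] := boolP (f k); rewrite /= ?(negPf nfk).
  have cS i : (a i.+1 <= c f k.+1)%O -> f i && (i < k.+1).
    have [fk|nfk] := boolP (f k); last first.
      by rewrite /= (negPf nfk) => /ck/andP[-> /ltnW].
    rewrite le_eqVlt => /orP[/eqP aE|].
      (* The new point is no [a i.+1], since [a k.+1] lies strictly below it and has empty
         valuation. *)
      have := a_below i.+1 (a k.+1); rewrite va; case=> //.
      by rewrite aE (ckS fk).2 /= lexx orbT.
    rewrite (ckS fk).2 /= orbF => /orP[/ck/andP[-> /ltnW] //|/a_inj[->]].
    by rewrite fk ltnS leqnn.
  by split=> //; split=> // fS; apply: cov.
exists (fun f => downK (c f)); split; last first.
  move=> f; apply: chain_join_irreducible => k.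
  have [_ [_ ckS]] := cP f k.
  have [fk|nfk] := boolP (f k); last by rewrite /= (negPf nfk).
  by apply: ltW; rewrite (ckS fk).2 /= lexx.
have memI (f : nat -> bool) k : \val (downK (c f)) (a k.+1) <-> f k.
  split; first by case=> m; have [_ [ck _]] := cP f m; move=> /ck/andP[].
  move=> fk; exists k.+1; apply: ltW; have [_ [_ /(_ fk) ckS]] := cP f k.
  by rewrite ckS.2 /= lexx orbT.
move=> f g fg; apply/funext => k.
by apply/idP/idP => /memI; [rewrite fg|rewrite -fg] => /memI.
Qed.

End Points.

Theorem proposition7p3 (n : nat) (hn : (1 < n)%N) :
  [set a : Fhat n | join_irreducible a] #= [set: nat -> bool].
Proof.
have [I [I_inj I_irr]] := exists_coding hn.
apply: Cantor_Bernstein.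
  (* Upper bound: points are natural numbers, so a decreasing set is determined by a characteristic
     function on [nat]. *)
  pose code (a : Fhat n) (k : nat) := `[< exists2 x, \val a x & \val x = k >].
  apply/pcard_injP; exists code => a b _ _ ab; apply: val_inj.
  have sub (a' b' : Fhat n) : code a' = code b' -> \val a' `<=` \val b'.
    move=> e x ax; have : code a' (\val x) by apply/asboolP; exists x.
    by rewrite e => /asboolP[y yb /val_inj <-].
  by apply/seteqP; split; apply: sub.
have IT : I @^-1` [set a | join_irreducible a] = setT.
  by apply/seteqP; split=> // f _; apply: I_irr.
by rewrite -IT; apply: card_ge_preimage => f g _ _; apply: I_inj.
Qed.
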